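(* Let $\mathfrak m\ne0$ be a multisegment and let $c$ be the largest endpoint occurring in $\mathfrak m$. Let $A_1,\ldots,A_r$ be the listing of $\mathfrak m_c$ in non-decreasing order of beginnings, let $\sigma$ be a listing of $\mathfrak m_{c-1}$ that is admissible for $\mathfrak m$, and let $\rho$ be any standard order of $\mathfrak m-\mathfrak m_c-\mathfrak m_{c-1}$. Suppose that the (standard) order $\mathcal O=(A_1,\ldots,A_r,\sigma,\rho)$ of $\mathfrak m$, obtained by concatenation, admits a relevant decomposition. Then $\nu^{-1}\mathfrak m_c\le\mathfrak m_{c-1}$. Moreover, the standard order $(\sigma',\rho)$ of $\mathfrak m-\mathfrak m_c-\nu^{-1}\mathfrak m_c$ admits a relevant decomposition, where $\sigma'$ is obtained from $\sigma$ by deleting one occurrence of $\nu^{-1}A_i$ for each $1\le i\le r$.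
   Context: A segment is a set $[a,b]=\{a,a+1,\ldots,b\}$ of consecutive integers, $a\le b$; write $\mathbf b([a,b])=a$ (beginning), $\mathbf e([a,b])=b$ (endpoint), and $\mathrm{Sgm}$ for the set of segments. Put $\nu[a,b]=[a+1,b+1]$. A multisegment is a finitely supported function $\mathfrak m:\mathrm{Sgm}\to\mathbb Z_{\ge0}$ (a finite multiset of segments); sums, differences and $\le$ are pointwise; $(\nu^n\mathfrak m)(\Delta)=\mathfrak m(\nu^{-n}\Delta)$. For $x\in\mathbb Z$, $\mathfrak m_x$ is the sub-multiset of all segments of $\mathfrak m$ with endpoint $x$ (possibly zero). An order (or listing) of $\mathfrak m$ is a sequence $(\Delta_1,\ldots,\Delta_k)$ in which each segment $\Delta$ occurs exactly $\mathfrak m(\Delta)$ times. Write $[a,b]\prec[a',b']$ if $a<a'$, $b<b'$ and $b\ge a'-1$. An order is standard if $\Delta_i\not\prec\Delta_j$ whenever $i<j$. Admissibility: with $c$ the largest endpoint of $\mathfrak m$, a listing $\sigma$ of $\mathfrak m_{c-1}$ is admissible for $\mathfrak m$ if (A1) for every $B\in\mathrm{supp}(\nu^{-1}\mathfrak m_c)$, every occurrence of $B$ in $\sigma$ follows every occurrence of a segment $\Gamma\in\mathfrak m_{c-1}$ with $\mathbf b(\Gamma)>\mathbf b(B)$; and (A2) all occurrences of any given segment occupy consecutive positions in $\sigma$. A decomposition of a segment $\Delta$ is a tuple of segments $(\Delta_1,\ldots,\Delta_s)$, $s\ge1$, with $\mathbf e(\Delta_1)=\mathbf e(\Delta)$,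 $\mathbf b(\Delta_s)=\mathbf b(\Delta)$ and $\mathbf e(\Delta_{i+1})=\mathbf b(\Delta_i)-1$ for $1\le i\le s-1$. A decomposition of an order $(\Delta_1,\ldots,\Delta_k)$ is a choice of a decomposition $(\Delta_{i,1},\ldots,\Delta_{i,k_i})$ of each $\Delta_i$; its index set is $I=\{(i,j):1\le i\le k,\ 1\le j\le k_i\}$, ordered lexicographically ($\prec_{\mathrm{lex}}$), and $(i,j)\ll(i',j')$ means $i<i'$. The decomposition is relevant to the order if there is an involution $\tau:I\to I$ with: (R1) $\tau(i,j+1)\ll\tau(i,j)$ for all $1\le i\le k$, $1\le j\le k_i-1$; (R2) $\tau(\imath)\ne\imath$ for all $\imath\in I$; (R3) $\Delta_\imath=\nu\Delta_{\tau(\imath)}$ whenever $\imath\prec_{\mathrm{lex}}\tau(\imath)$. The empty order of the zero multisegment admits the (empty) relevant decomposition. *)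

(* Defs.v *)
From HB Require Import structures.
From mathcomp Require Import all_boot all_order all_algebra.
From mathcomp Require Export finmap multiset.

Set Implicit Arguments.
Unset Strict Implicit.
Unset Printing Implicit Defensive.

Import Order.TTheory GRing.Theory Num.Theory.
Local Open Scope ring_scope.

(* The segment {a, a + 1, ..., b} is encoded by the pair (a, b) of its least
   and largest elements, which determines it. *)
Record segment := Segment {
  seg_ends : int * int;
  _ : seg_ends.1 <= seg_ends.2
}.

HB.instance Definition _ := [isSub for seg_ends].
HB.instance Definition _ := [Choice of segment by <:].

Definition beginning (D : segment) : int := (seg_ends D).1.
Definition endpoint (D : segment) : int := (seg_ends D).2.

Lemma beginning_le_endpoint (D : segment) : beginning D <= endpoint D.
Proof. by case: D. Qed.

Lemma segmentP (D D' : segment) :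
  beginning D = beginning D' -> endpoint D = endpoint D' -> D = D'.
Proof.
move=> hb he; apply: val_inj => /=; move: hb he; rewrite /beginning /endpoint.
by case: (seg_ends D) (seg_ends D') => [a b] [a' b'] /= -> ->.
Qed.

Fact nu_subproof (n : int) (D : segment) :
  (beginning D + n, endpoint D + n).1 <= (beginning D + n, endpoint D + n).2.
Proof. by rewrite lerD2r beginning_le_endpoint. Qed.

(* nu n D is $\nu^n \Delta$. *)
Definition nu (n : int) (D : segment) : segment := Segment (nu_subproof n D).

Lemma nuK (n : int) : cancel (nu n) (nu (- n)).
Proof.
by move=> D; apply: segmentP; rewrite /beginning /endpoint /= addrK.
Qed.

Lemma nuNK (n : int) : cancel (nu (- n)) (nu n).
Proof. by move=> D; rewrite -{1}[n]opprK nuK. Qed.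

(* D \prec D' *)
Definition prec (D D' : segment) : bool :=
  [&& beginning D < beginning D', endpoint D < endpoint D'
    & beginning D' - 1 <= endpoint D].

Definition multisegment := {mset segment}%mset.

Fact mnu_key : unit. Proof. exact: tt. Qed.
Definition mnu (n : int) (m : multisegment) : multisegment :=
  [mset[mnu_key] D in [fset nu n D' | D' in finsupp m]%fset
     => m (nu (- n) D)]%mset.

Lemma mnuE (n : int) (m : multisegment) (D : segment) :
  mnu n m D = m (nu (- n) D).
Proof.
rewrite fsfunE; case: ifPn => // DNm; apply/esym/eqP.
apply: contraNT DNm; rewrite -mem_finsupp => Dm.
by apply/imfsetP; exists (nu (- n) D); rewrite ?nuNK.
Qed.

Fact with_endpoint_key : unit. Proof. exact: tt. Qed.
(* $\mathfrak m_x$ *)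
Definition with_endpoint (m : multisegment) (x : int) : multisegment :=
  [mset[with_endpoint_key] D in finsupp m
     => if endpoint D == x then m D else 0%N]%mset.

Lemma with_endpointE (m : multisegment) (x : int) (D : segment) :
  with_endpoint m x D = if endpoint D == x then m D else 0%N.
Proof.
rewrite fsfunE; case: ifPn => // DNm.
by case: finsuppP DNm => // _ _; case: ifP.
Qed.

Definition largest_endpoint (m : multisegment) (c : int) : Prop :=
  (exists2 D, D \in m & endpoint D = c)
  /\ (forall D, D \in m -> endpoint D <= c).

Definition is_order (m : multisegment) (s : seq segment) : Prop :=
  forall D, count_mem D s = m D.

Definition standard (s : seq segment) : bool :=
  pairwise (fun D D' => ~~ prec D D') s.

(* (A1) and (A2); onth s i = Some D says that position i of s is an
   occurrence of D. *)
Definition admissible (m : multisegment) (c : int) (s : seq segment) : Prop :=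
  (forall B G : segment,
     B \in mnu (-1) (with_endpoint m c) ->
     G \in with_endpoint m (c - 1) ->
     beginning B < beginning G ->
     forall i j : nat, onth s i = Some G -> onth s j = Some B -> (i < j)%N)
  /\ (forall (D : segment) (i j k : nat), (i < j < k)%N ->
        onth s i = Some D -> onth s k = Some D -> onth s j = Some D).

Definition seg_decomposition (D : segment) (d : seq segment) : bool :=
  if d is D1 :: d' then
    [&& endpoint D1 == endpoint D, beginning (last D1 d') == beginning D
      & path (fun E E' => endpoint E' == beginning E - 1) D1 d']
  else false.

Definition order_decomposition (s : seq segment) (dd : seq (seq segment)) :
  bool := all2 seg_decomposition s dd.

(* Indices start at 0: (i, j) here is the index (i + 1, j + 1). *)
Definition in_index (dd : seq (seq segment)) (p : nat * nat) : bool :=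
  (p.1 < size dd)%N && (p.2 < size (nth [::] dd p.1))%N.

Definition lex_lt (p q : nat * nat) : bool :=
  (p.1 < q.1)%N || ((p.1 == q.1) && (p.2 < q.2)%N).

Definition row_lt (p q : nat * nat) : bool := (p.1 < q.1)%N.

(* The default value of nth; it is never reached at an index of dd. *)
Definition seg0 : segment := @Segment (0, 0) (lexx 0).

Definition seg_at (dd : seq (seq segment)) (p : nat * nat) : segment :=
  nth seg0 (nth [::] dd p.1) p.2.

(* tau is a map on all pairs that restricts to an involution of the index
   set; its values elsewhere are irrelevant. *)
Definition relevant (dd : seq (seq segment)) : Prop :=
  exists tau : nat * nat -> nat * nat,
    [/\ (forall p, in_index dd p -> in_index dd (tau p) /\ tau (tau p) = p),
        (forall i j : nat, in_index dd (i, j.+1) ->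
           row_lt (tau (i, j.+1)) (tau (i, j))),
        (forall p, in_index dd p -> tau p <> p)
      & (forall p, in_index dd p -> lex_lt p (tau p) ->
           seg_at dd p = nu 1 (seg_at dd (tau p)))].

Definition admits_relevant_decomposition (s : seq segment) : Prop :=
  exists dd, order_decomposition s dd /\ relevant dd.

(* s' is obtained from s by deleting one (arbitrary) occurrence of each entry
   of xs, entries of xs being counted with multiplicity. *)
Fixpoint deletes (xs s s' : seq segment) : Prop :=
  if xs is x :: xs' then
    exists s1 s2, s = s1 ++ x :: s2 /\ deletes xs' (s1 ++ s2) s'
  else s' = s.

(* Main.v *)
Require Import Defs.
From mathcomp Require Import all_boot all_order all_algebra.
From mathcomp Require Import zify.

(** The theorem follows by induction on the list A, peeling off its first
    segment a, which has the least beginning among the segments with endpoint c.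

    Nothing precedes the row of a, and no row is matched with itself.  So every
    piece of a is matched with a piece of a later row, its translate by -1; and
    by (R1) this partner is the last piece of its row, since a further piece
    would have to be matched with a piece before the row of a
    ([matching_first_row]).  Two consequences: the row matched with the j-th
    piece begins just before that piece begins, and these rows move backwards
    as j grows.

    The row of the last piece begins at b(a) - 1, which is too far left for a
    segment of A; so it, and with it all the other rows in question, lies in
    sigma or later.  The row of the first piece contains a piece with endpoint
    c - 1, so it lies in sigma, and hence so do all the others.  There that
    piece, being at once the leading and the last one, is the whole row.  If a
    had at least two pieces, the row of the last one would be an occurrence of
    nu^-1 a lying in sigma strictly before the row of the first one, which has
    a larger beginning: this contradicts (A1).  Hence a is undivided and is
    matched with an undivided occurrence of nu^-1 a in sigma.  The involution
    restricts to the complement of these two rows ([relevant_delete_pair]), and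
    the induction goes on with the rest of A ([relevant_first_segment]).

    The occurrence of nu^-1 a found in this way need not be the one that a given
    sigma' omits; but by (A2) equal segments are adjacent in sigma, so deleting
    one or another leaves the same list ([grouped_delete]). *)

Import Order.TTheory GRing.Theory Num.Theory.
Local Open Scope ring_scope.

(** * Decompositions of one segment and of an order *)

Lemma beginning_nu (n : int) (D : segment) :
  beginning (nu n D) = beginning D + n.
Proof. by []. Qed.

Lemma endpoint_nu (n : int) (D : segment) : endpoint (nu n D) = endpoint D + n.
Proof. by []. Qed.

Section SegmentDecomposition.
Context {D : segment} {d : seq segment} (decD : seg_decomposition D d).

Lemma seg_decomposition_size_gt0 : (0 < size d)%N.
Proof. by move: decD; case: d. Qed.

Lemma seg_decomposition_endpoint : endpoint (nth seg0 d 0) = endpoint D.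
Proof. by move: decD; case: d => //= D1 d' /and3P[/eqP]. Qed.

Lemma seg_decomposition_beginning :
  beginning (nth seg0 d (size d).-1) = beginning D.
Proof.
by move: decD; rewrite nth_last; case: d => //= D1 d' /and3P[_ /eqP].
Qed.

Lemma seg_decomposition_descends (i j : nat) : (i < j < size d)%N ->
  endpoint (nth seg0 d j) < beginning (nth seg0 d i).
Proof.
have trans : transitive (fun E E' => endpoint E' < beginning E).
  move=> E F G FE EG.
  by rewrite (lt_trans EG) // (le_lt_trans (beginning_le_endpoint E)).
have : pairwise (fun E E' => endpoint E' < beginning E) d.
  rewrite -sorted_pairwise //.
  move: decD; case: d => //= D1 d' /and3P[_ _]; apply: sub_path => E E' /eqP.
  lia.
move=> /(pairwiseP seg0) desc /andP[lt_ij lt_j].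
by apply: desc => //; rewrite inE //; exact: ltn_trans lt_j.
Qed.

End SegmentDecomposition.

Lemma order_decomposition_size (s : seq segment) (dd : seq (seq segment)) :
  order_decomposition s dd -> size dd = size s.
Proof. by rewrite /order_decomposition all2E => /andP[/eqP]. Qed.

Lemma order_decomposition_nth (s : seq segment) (dd : seq (seq segment))
    (i : nat) :
  order_decomposition s dd -> (i < size s)%N ->
  seg_decomposition (nth seg0 s i) (nth [::] dd i).
Proof.
elim: s dd i => [|D s IH] [|d dd] [|i] //= /andP[] //.
by move=> _ /IH; apply.
Qed.

Lemma order_decomposition_delete (s : seq segment) (dd : seq (seq segment))
    (i : nat) :
  order_decomposition s dd ->
  order_decomposition (take i s ++ drop i.+1 s) (take i dd ++ drop i.+1 dd).
Proof.
elim: s dd i => [|D s IH] [|d dd] [|i] //= /andP[] //.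
  by rewrite !drop0.
by move=> -> /IH; apply.
Qed.

(** * Involutions on the index set *)

(** The condition that [relevant] imposes on the involution, named so that the
    involution can be kept track of. *)
Definition matching (dd : seq (seq segment)) (tau : nat * nat -> nat * nat) :=
  [/\ (forall p, in_index dd p -> in_index dd (tau p) /\ tau (tau p) = p),
      (forall i j : nat, in_index dd (i, j.+1) ->
         row_lt (tau (i, j.+1)) (tau (i, j))),
      (forall p, in_index dd p -> tau p <> p)
    & (forall p, in_index dd p -> lex_lt p (tau p) ->
         seg_at dd p = nu 1 (seg_at dd (tau p)))].

Section Matching.
Context {dd : seq (seq segment)} {tau : nat * nat -> nat * nat}
  (tauP : matching dd tau).

Lemma matching_row_lt (i j k : nat) :
  (j < k)%N -> in_index dd (i, k) -> ((tau (i, k)).1 < (tau (i, j)).1)%N.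
Proof.
have [_ R1 _ _] := tauP.
elim: k => // k IH; rewrite ltnS leq_eqVlt => /orP[/eqP->|lt_jk] ik.
  exact: R1.
apply: ltn_trans (R1 _ _ ik) (IH lt_jk _).
by move: ik; rewrite /in_index /=; lia.
Qed.

(** If (i, j) and (i, k) were matched with j < k, then (R1) would put the
    partner of (i, k) in a row before that of the partner of (i, j), while both
    are in row i; and j = k is (R2). *)
Lemma matching_row_neq (i j : nat) :
  in_index dd (i, j) -> (tau (i, j)).1 != i.
Proof.
move=> ij; have [invo _ R2 _] := tauP.
have [tij ttij] := invo _ ij; have := R2 _ ij.
case def_t: (tau (i, j)) tij ttij => [i' k] /= ik tik neq.
apply/eqP => eq_i; rewrite eq_i {i' eq_i} in def_t ik tik neq.
have [lt_jk | lt_kj | eq_jk] := ltngtP j k.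
- by have := matching_row_lt _ _ _ lt_jk ik; rewrite tik def_t ltnn.
- by have := matching_row_lt _ _ _ lt_kj ij; rewrite tik def_t ltnn.
- by apply: neq; rewrite eq_jk.
Qed.

(** If the partner of a piece of the first row had a successor in its own row,
    the partner of this successor would lie before the first row, by (R1). *)
Lemma matching_first_row (j : nat) : in_index dd (0%N, j) ->
  [/\ (0 < (tau (0, j)).1 < size dd)%N,
      size (nth [::] dd (tau (0, j)).1) = (tau (0, j)).2.+1
    & seg_at dd (0%N, j) = nu 1 (seg_at dd (tau (0%N, j)))].
Proof.
move=> oj; have [invo R1 _ R3] := tauP.
have [toj ttoj] := invo _ oj.
have t_gt0 : (0 < (tau (0, j)).1)%N by rewrite lt0n matching_row_neq.
have := R3 _ oj; rewrite /lex_lt t_gt0 => /(_ isT) eq_seg.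
case: (tau (0, j)) toj ttoj t_gt0 eq_seg => i k ik tik /= i_gt0 eq_seg.
split => //.
  by case/andP: ik.
apply/eqP; rewrite eqn_leq; case/andP: (ik) => /= lt_i ->; rewrite andbT.
rewrite leqNgt; apply/negP => lt_k.
by have := R1 i k; rewrite /in_index /= lt_i lt_k tik /row_lt ltn0 => /(_ isT).
Qed.

End Matching.

(** Two rows made of one piece each and matched with each other form a union of
    orbits of the involution, so it restricts to the other rows, whose relative
    positions do not change. *)
Lemma relevant_delete_pair (d : seq segment) (dd : seq (seq segment))
    (tau : nat * nat -> nat * nat) (R : nat) :
  matching (d :: dd) tau -> size d = 1%N -> size (nth [::] dd R) = 1%N ->
  tau (0, 0)%N = (R.+1, 0)%N -> relevant (take R dd ++ drop R.+1 dd).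
Proof.
move=> tauP size_d size_R tau00.
have lt_R : (R < size dd)%N.
  by rewrite ltnNge; apply/negP => /(nth_default [::]) eR; rewrite eR in size_R.
set dd' := take R dd ++ drop R.+1 dd.
(* f i is the row of d :: dd that becomes row i of dd'. *)
pose f i := (bump R i).+1.
have nth_f i : nth [::] dd' i = nth [::] (d :: dd) (f i).
  rewrite /= nth_cat size_take lt_R /bump.
  case: ltnP => [lt_i | le_i]; first by rewrite nth_take.
  by rewrite nth_drop; congr nth; lia.
have size_dd' : size dd' = (size dd).-1.
  by rewrite size_cat size_take size_drop lt_R; lia.
have f_lt i : (f i < size (d :: dd))%N = (i < size dd')%N.
  by rewrite size_dd' /f /bump /=; lia.
have in_f i j : in_index (d :: dd) (f i, j) = in_index dd' (i, j).
  exact: (congr2 (fun b d => b && (j < size d)%N) (f_lt i) (esym (nth_f i))).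
have [invo R1 R2 R3] := tauP.
have o0 : in_index (d :: dd) (0, 0)%N by rewrite /in_index /= size_d.
have tauR : tau (R.+1, 0)%N = (0, 0)%N by rewrite -tau00; case: (invo _ o0).
pose tau' p := (unbump R (tau (f p.1, p.2)).1.-1, (tau (f p.1, p.2)).2).
have f_tau' p : in_index dd' p ->
    (f (tau' p).1, (tau' p).2) = tau (f p.1, p.2).
  case: p => i j; rewrite -in_f /tau' /= => /invo.
  case: (tau (f i, j)) => [[|a] b] [/andP[/= _ lt_b] tab].
    move: lt_b tab; rewrite size_d ltnS leqn0 => /eqP ->.
    by rewrite tau00 => -[/eqP]; rewrite (negPf (neq_bump R i)).
  rewrite /f unbumpK // inE; apply/eqP => eq_a.
  by move: lt_b tab; rewrite eq_a size_R ltnS leqn0 => /eqP ->; rewrite tauR.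
have in_tau' p : in_index dd' p -> in_index (d :: dd) (tau (f p.1, p.2)).
  by case: p => i j; rewrite -in_f => /invo[].
have f_lt2 i k : (f i < f k)%N = (i < k)%N.
  by rewrite /f ltnS !ltnNge leq_bump2.
have seg_f i j : seg_at dd' (i, j) = seg_at (d :: dd) (f i, j).
  by rewrite /seg_at -nth_f.
exists tau'; split.
- move=> [i j] ij; have := f_tau' _ ij; have := in_tau' _ ij.
  case def_t: (tau' (i, j)) => [a b] /= t_in def_f.
  rewrite -def_f in_f in t_in; split=> //.
  have := f_tau' _ t_in; case: (tau' (a, b)) => a' b' /=.
  rewrite def_f (proj2 (invo _ _)) ?in_f // => -[].
  by move=> /(can_inj (bumpK R)) -> ->.
- move=> i j ij1.
  have ij : in_index dd' (i, j) by move: ij1; rewrite /in_index /=; lia.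
  rewrite /row_lt -f_lt2.
  have /= := congr1 fst (f_tau' _ ij); have /= := congr1 fst (f_tau' _ ij1).
  by move=> -> ->; apply: R1; rewrite in_f.
- move=> [i j] ij eq_t; have := f_tau' _ ij; rewrite eq_t /= => /esym.
  by apply: R2; rewrite in_f.
- move=> [i j] ij lt_t.
  have := f_tau' _ ij; case: (tau' (i, j)) lt_t => a b lt_t /= def_t.
  rewrite !seg_f def_t; apply: R3; rewrite ?in_f //.
  rewrite -def_t; move: lt_t; rewrite /lex_lt /= f_lt2.
  by case/orP=> [-> // | /andP[/eqP -> ->]]; rewrite eqxx orbT.
Qed.

(** * Removing the first segment together with its partner *)

Lemma delete_nth_mid {T : Type} (x0 : T) (s1 s2 s3 : seq T) (i : nat) :
  (size s1 <= i < size s1 + size s2)%N ->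
  exists t1 t2, s2 = t1 ++ nth x0 (s1 ++ s2 ++ s3) i :: t2
    /\ take i (s1 ++ s2 ++ s3) ++ drop i.+1 (s1 ++ s2 ++ s3)
       = s1 ++ (t1 ++ t2) ++ s3.
Proof.
move=> /andP[le_i lt_i].
have lt_i2 : (i - size s1 < size s2)%N by rewrite ltn_subLR.
exists (take (i - size s1) s2), (drop (i - size s1).+1 s2).
rewrite nth_cat ltnNge le_i nth_cat lt_i2 -drop_nth // cat_take_drop; split=> //.
rewrite take_cat ltnNge le_i take_cat lt_i2 drop_cat ltnNge.
rewrite (leq_trans le_i) //= -!catA subSn // drop_cat.
case: ltnP => // le_s2; rewrite [drop _ s2]drop_oversize //.
have -> : ((i - size s1).+1 - size s2 = 0)%N by apply/eqP.
by rewrite drop0.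
Qed.

(** The inductive step.  The fourth hypothesis is what (A1) says about the
    occurrences of nu^-1 a. *)
Lemma relevant_first_segment (a : segment) (A sigma rho : seq segment) :
  all (fun D => beginning a <= beginning D) A ->
  all (fun D => endpoint D == endpoint a - 1) sigma ->
  all (fun D => endpoint D < endpoint a - 1) rho ->
  pairwise (fun D D' => (D == nu (-1) a) ==> (beginning D' <= beginning D))
    sigma ->
  admits_relevant_decomposition (a :: A ++ sigma ++ rho) ->
  exists s1 s2, sigma = s1 ++ nu (-1) a :: s2
    /\ admits_relevant_decomposition (A ++ (s1 ++ s2) ++ rho).
Proof.
move=> beg_A end_sigma end_rho sigma_adm [[|d dd] [dec [tau tauP]]] //.
have /andP[dec_d dec_dd] : seg_decomposition a d &&
  order_decomposition (A ++ sigma ++ rho) dd := dec.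
set s := A ++ sigma ++ rho in dec_dd.
have size_dd := order_decomposition_size _ _ dec_dd.
have k_gt0 := seg_decomposition_size_gt0 dec_d.
have partner j : (j < size d)%N -> exists i,
    [/\ tau (0, j)%N = (i.+1, (size (nth [::] dd i)).-1), (i < size s)%N,
        beginning (nth seg0 s i) = beginning (nth seg0 d j) - 1
      & endpoint (nth seg0 (nth [::] dd i) (size (nth [::] dd i)).-1)
        = endpoint (nth seg0 d j) - 1].
  move=> lt_j; have := matching_first_row tauP j; rewrite /in_index lt_j.
  case: (tau (0, j)%N) => [[|i] l] [] //=; rewrite ltnS size_dd => lt_i size_i.
  rewrite /seg_at /= => ->; exists i; rewrite size_i; split=> //.
    have := seg_decomposition_beginning (order_decomposition_nth _ _ _ dec_dd lt_i).
    by rewrite size_i beginning_nu /= => ->; rewrite addrK.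
  by rewrite endpoint_nu addrK.
(* i0 and i1 are the rows matched with the first and the last piece of a. *)
have [i0 [tau0 lt_i0 beg_i0 end_i0]] := partner _ k_gt0.
have lt_last : ((size d).-1 < size d)%N by rewrite prednK.
have [i1 [tau1 lt_i1 beg_i1 _]] := partner _ lt_last.
rewrite (seg_decomposition_beginning dec_d) in beg_i1.
rewrite (seg_decomposition_endpoint dec_d) in end_i0.
have le_A_i1 : (size A <= i1)%N.
  rewrite leqNgt; apply/negP => lt_i1A.
  have := all_nthP seg0 beg_A _ lt_i1A.
  by move: beg_i1; rewrite /s nth_cat lt_i1A; lia.
have lt_i1_i0 : (1 < size d)%N -> (i1 < i0)%N.
  move=> k_gt1.
  have := matching_row_lt tauP 0 0 (size d).-1; rewrite /in_index tau0 tau1 /=.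
  by rewrite lt_last ltnS; apply; lia.
have eq_i1_i0 : size d = 1%N -> i1 = i0.
  by move=> k1; move: tau1; rewrite k1 tau0 => -[].
have le_i1_i0 : (i1 <= i0)%N.
  by case: (ltngtP 1 (size d)) => [/lt_i1_i0/ltnW||/esym/eq_i1_i0]; lia.
have dec_i0 := order_decomposition_nth _ _ _ dec_dd lt_i0.
set d0 := nth [::] dd i0 in tau0 end_i0 dec_i0.
have d0_gt0 := seg_decomposition_size_gt0 dec_i0.
have end_d0 : (1 < size d0)%N -> endpoint a - 1 < endpoint (nth seg0 s i0).
  move=> d0_gt1; rewrite -end_i0 -(seg_decomposition_endpoint dec_i0).
  apply: lt_le_trans _ (beginning_le_endpoint _).
  by apply: (seg_decomposition_descends dec_i0); lia.
have end_d1 : endpoint a - 1 <= endpoint (nth seg0 s i0).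
  rewrite -end_i0; have [/end_d0 | | d01] := ltngtP 1 (size d0); try lia.
  by rewrite -d01 (seg_decomposition_endpoint dec_i0).
have s_sigma i : (size A <= i < size A + size sigma)%N ->
    nth seg0 s i = nth seg0 sigma (i - size A).
  move=> ?; rewrite /s nth_cat ifF; last by lia.
  by rewrite nth_cat ifT //; lia.
have lt_i0_sigma : (i0 < size A + size sigma)%N.
  rewrite ltnNge; apply/negP => le_i0.
  have lt_rho : (i0 - size A - size sigma < size rho)%N.
    by move: lt_i0; rewrite /s !size_cat; lia.
  have := all_nthP seg0 end_rho _ lt_rho.
  by move: end_d1; rewrite /s !nth_cat !ifF /=; lia.
have end_s i : (size A <= i < size A + size sigma)%N ->
    endpoint (nth seg0 s i) = endpoint a - 1.
  move=> i_sigma; rewrite s_sigma //; apply/eqP.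
  by apply: (all_nthP seg0 end_sigma); lia.
have size_d0 : size d0 = 1%N.
  apply/eqP; rewrite eqn_leq d0_gt0 andbT leqNgt; apply/negP => /end_d0.
  by rewrite end_s; lia.
have nth_i1 : nth seg0 s i1 = nu (-1) a.
  by apply: segmentP; rewrite ?beg_i1 ?end_s //; lia.
(* Row i1 is an occurrence of nu^-1 a; if it preceded row i0, sigma_adm would
   bound the beginning of row i0 by that of nu^-1 a. *)
have size_d : size d = 1%N.
  apply/eqP; rewrite eqn_leq k_gt0 andbT leqNgt; apply/negP => k_gt1.
  have := pairwiseP seg0 sigma_adm (i1 - size A)%N (i0 - size A)%N.
  rewrite !inE -!s_sigma ?nth_i1 ?eqxx ?beg_i0 ?beginning_nu /=; try lia.
  have := seg_decomposition_descends dec_d 0 (size d).-1.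
  have := beginning_le_endpoint (nth seg0 d (size d).-1).
  rewrite (seg_decomposition_beginning dec_d).
  have := lt_i1_i0 k_gt1.
  lia.
have i10 := eq_i1_i0 size_d; rewrite -i10 in tau0 size_d0 lt_i0_sigma.
have [|t1 [t2 [def_sigma def_s]]] :=
  delete_nth_mid seg0 A sigma rho i1; first by lia.
exists t1, t2; rewrite -nth_i1; split=> //.
rewrite -def_s; exists (take i1 dd ++ drop i1.+1 dd); split.
  exact: order_decomposition_delete.
apply: relevant_delete_pair tauP size_d _ _; first by rewrite i10.
by rewrite tau0 size_d0.
Qed.

(** * Deleting occurrences from a listing *)

(** Condition (A2), in a form that visibly passes to sublists. *)
Definition grouped (s : seq segment) : Prop :=
  forall D E, subseq [:: D; E; D] s -> E = D.

Lemma grouped_subseq (s t : seq segment) : subseq s t -> grouped t -> grouped s.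
Proof.
by move=> s_t grp D E DED; apply: (grp D E); apply: subseq_trans DED s_t.
Qed.

Lemma subseq_cons_split {T : eqType} (x : T) (t s : seq T) :
  subseq (x :: t) s -> exists s1 s2, s = s1 ++ x :: s2 /\ subseq t s2.
Proof.
elim: s => //= y s IH; case: eqP => [<- t_s | _ /IH[s1 [s2 [-> t_s2]]]].
  by exists [::], s.
by exists (y :: s1), s2.
Qed.

Lemma onth_grouped (s : seq segment) :
  (forall (D : segment) (i j k : nat), (i < j < k)%N ->
     onth s i = Some D -> onth s k = Some D -> onth s j = Some D) ->
  grouped s.
Proof.
move=> consec D E /subseq_cons_split[s1 [t [def_s /subseq_cons_split]]].
move=> [s2 [u [def_t /subseq_cons_split[s3 [s4 [def_u _]]]]]].
rewrite {}def_s {}def_t {}def_u in consec.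
have onth_mid (r1 r2 : seq segment) F : onth (r1 ++ F :: r2) (size r1) = Some F.
  by rewrite onth_cat ltnn subnn.
pose i := size s1; pose j := size (s1 ++ D :: s2).
pose k := size (s1 ++ D :: s2 ++ E :: s3).
have := consec D i j k; rewrite !onth_mid.
have -> : onth (s1 ++ D :: s2 ++ E :: s3 ++ D :: s4) j = Some E.
  by rewrite -(onth_mid (s1 ++ D :: s2) (s3 ++ D :: s4) E) -catA.
have -> : onth (s1 ++ D :: s2 ++ E :: s3 ++ D :: s4) k = Some D.
  by rewrite -(onth_mid (s1 ++ D :: s2 ++ E :: s3) s4 D) /= -!catA /= -catA.
have ijk : (i < j < k)%N by rewrite /i /j /k !size_cat /= !size_cat /=; lia.
by case/(_ ijk erefl erefl).
Qed.

(** In a grouped list the outcome of a deletion does not depend on the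
    occurrence deleted, and [rem], which deletes the first one, is a canonical
    name for it. *)
Lemma grouped_delete (D : segment) (s1 s2 : seq segment) :
  grouped (s1 ++ D :: s2) -> s1 ++ s2 = rem D (s1 ++ D :: s2).
Proof.
elim: s1 => [|E s1 IH] grp /=; first by rewrite eqxx.
case: eqP => [eq_E | _]; last first.
  by rewrite -IH //; apply: grouped_subseq grp; apply: subseq_cons.
have {grp}: {in s1, forall F, F = D}.
  move=> F F_s1; apply: grp; rewrite eq_E /= eqxx.
  by apply: (@cat_subseq _ [:: F] [:: D] s1); rewrite sub1seq ?mem_head.
rewrite {E}eq_E => {IH}; elim: s1 => //= F s1 IH eq_D.
rewrite (eq_D F) ?mem_head // -IH // => G G_s1.
by apply: eq_D; rewrite inE G_s1 orbT.
Qed.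

Lemma deletes_subseq (xs s s' : seq segment) : deletes xs s s' -> subseq s' s.
Proof.
elim: xs s => [|x xs IH] s /=; first by move=> ->.
move=> [s1 [s2 [-> /IH s'_s]]]; apply: subseq_trans s'_s _.
by apply: cat_subseq; rewrite ?subseq_cons.
Qed.

Lemma deletes_count_mem (xs s s' : seq segment) (D : segment) :
  deletes xs s s' -> count_mem D s = (count_mem D xs + count_mem D s')%N.
Proof.
elim: xs s => [|x xs IH] s /=; first by move=> ->.
by move=> [s1 [s2 [-> /IH]]]; rewrite !count_cat /=; lia.
Qed.

(** * Induction on the segments with the largest endpoint *)

Lemma relevant_deletes (c : int) (A sigma rho : seq segment) :
  sorted (fun D D' => beginning D <= beginning D') A ->
  all (fun D => endpoint D == c) A ->
  all (fun D => endpoint D == c - 1) sigma ->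
  all (fun D => endpoint D < c - 1) rho ->
  {in A, forall a, pairwise
     (fun D D' => (D == nu (-1) a) ==> (beginning D' <= beginning D)) sigma} ->
  grouped sigma ->
  admits_relevant_decomposition (A ++ sigma ++ rho) ->
  (forall P, (count P [seq nu (-1) D | D <- A] <= count P sigma)%N)
  /\ (forall sigma', deletes [seq nu (-1) D | D <- A] sigma sigma' ->
        admits_relevant_decomposition (sigma' ++ rho)).
Proof.
move=> A_sorted end_A end_sigma end_rho.
elim: A sigma A_sorted end_A end_sigma => [|a A IH] sigma.
  by move=> _ _ _ _ _ adm; split=> // sigma' /= ->.
move=> A_sorted /= /andP[/eqP end_a end_A] end_sigma sigma_adm grp adm.
have beg_A : all (fun D => beginning a <= beginning D) A.
  by apply: order_path_min A_sorted => x y z; apply: le_trans.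
have [|||||s1 [s2 [def_sigma]]] := relevant_first_segment a A sigma rho.
- exact: beg_A.
- by rewrite end_a.
- by rewrite end_a.
- by apply: sigma_adm; apply: mem_head.
- exact: adm.
have sub_sigma : subseq (s1 ++ s2) sigma.
  by rewrite def_sigma; apply: cat_subseq; rewrite ?subseq_cons.
case/IH => {IH}.
- exact: path_sorted A_sorted.
- exact: end_A.
- by apply/allP => D /(mem_subseq sub_sigma); move/allP: end_sigma; apply.
- move=> b b_A; apply: subseq_pairwise sub_sigma _.
  by apply: sigma_adm; rewrite inE b_A orbT.
- exact: grouped_subseq sub_sigma grp.
move=> le_count del_adm; split.
  by move=> P; have := le_count P; rewrite def_sigma !count_cat /=; lia.
move=> sigma' [t1 [t2 [def_sigma' del]]]; apply: del_adm.
(* The occurrence matched with a may differ from the deleted one. *)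
rewrite (_ : s1 ++ s2 = t1 ++ t2) //.
rewrite (grouped_delete (nu (-1) a)) -?def_sigma //.
by rewrite (grouped_delete (nu (-1) a) t1) -?def_sigma'.
Qed.

Theorem theorem6p2 (m : multisegment) (c : int)
    (m_neq0 : m <> mset0)
    (c_max : largest_endpoint m c)
    (A sigma rho : seq segment)
    (A_order : is_order (with_endpoint m c) A)
    (A_sorted : sorted (fun D D' => (beginning D <= beginning D')%R) A)
    (sigma_order : is_order (with_endpoint m (c - 1)%R) sigma)
    (sigma_admissible : admissible m c sigma)
    (rho_order :
       is_order (m `\` with_endpoint m c `\` with_endpoint m (c - 1)%R)%mset rho)
    (rho_standard : standard rho) :
  (is_order m (A ++ sigma ++ rho) /\ standard (A ++ sigma ++ rho))
  /\ (admits_relevant_decomposition (A ++ sigma ++ rho) ->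
      (mnu (-1)%R (with_endpoint m c) `<=` with_endpoint m (c - 1)%R)%mset
      /\ (forall sigma' : seq segment,
            deletes [seq nu (-1)%R D | D <- A] sigma sigma' ->
            [/\ is_order
                  (m `\` with_endpoint m c `\` mnu (-1)%R (with_endpoint m c))%mset
                  (sigma' ++ rho),
                standard (sigma' ++ rho)
              & admits_relevant_decomposition (sigma' ++ rho)])).
Proof.
have rhoE D : count_mem D rho =
    (m D - with_endpoint m c D - with_endpoint m (c - 1) D)%N.
  by rewrite rho_order !msetE2.
have nuAE D : count_mem D [seq nu (-1) E | E <- A] =
    mnu (-1) (with_endpoint m c) D.
  rewrite mnuE opprK -A_order count_map; apply: eq_count => E /=.
  by apply/eqP/eqP => [<- | ->]; rewrite ?nuNK ?nuK.
have end_A : all (fun D => endpoint D == c) A.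
  apply/allP => D; rewrite -has_pred1 has_count A_order with_endpointE.
  by case: ifP.
have end_sigma : all (fun D => endpoint D == c - 1) sigma.
  apply/allP => D; rewrite -has_pred1 has_count sigma_order with_endpointE.
  by case: ifP.
have end_rho : all (fun D => endpoint D < c - 1) rho.
  apply/allP => D; rewrite -has_pred1 has_count rhoE !with_endpointE => D_rho.
  have /(proj2 c_max) : D \in m by rewrite -mset_gt0; move: D_rho; lia.
  by move: D_rho; do 2!case: eqP; lia.
have order_m : is_order m (A ++ sigma ++ rho).
  move=> D; rewrite !count_cat A_order sigma_order rhoE !with_endpointE.
  by do 2!case: eqP; lia.
have not_prec D D' : endpoint D' <= endpoint D -> ~~ prec D D'.
  by rewrite /prec; lia.
have standard_m : standard (A ++ sigma ++ rho).
  have same_end x s : all (fun D => endpoint D == x) s -> standard s.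
    move=> /(all_nthP seg0) end_s; apply/(pairwiseP seg0) => i j lt_i lt_j _.
    by apply: not_prec; rewrite (eqP (end_s _ lt_i)) (eqP (end_s _ lt_j)).
  have standard_A := same_end c A end_A.
  have standard_sigma := same_end (c - 1) sigma end_sigma.
  move: standard_A standard_sigma rho_standard.
  rewrite /standard !pairwise_cat allrel_catr => -> -> ->; rewrite !andbT.
  apply/andP; split; first (apply/andP; split); apply/allrelP => D D'.
  - move=> /(allP end_A)/eqP end_D /(allP end_sigma)/eqP end_D'.
    by apply: not_prec; lia.
  - move=> /(allP end_A)/eqP end_D /(allP end_rho) end_D'.
    by apply: not_prec; lia.
  - move=> /(allP end_sigma)/eqP end_D /(allP end_rho) end_D'.
    by apply: not_prec; lia.
split=> // adm.
have grp : grouped sigma by apply: onth_grouped; case: sigma_admissible.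
have sigma_adm : {in A, forall a, pairwise
    (fun D D' => (D == nu (-1) a) ==> (beginning D' <= beginning D)) sigma}.
  move=> a a_A; apply/(pairwiseP seg0) => i j; rewrite !inE => lt_i lt_j lt_ij.
  apply/implyP => /eqP nth_i; rewrite leNgt; apply/negP => lt_beg.
  have onth_s k : (k < size sigma)%N -> onth sigma k = Some (nth seg0 sigma k).
    by move=> lt_k; rewrite onthE (nth_map seg0).
  have nth_i_mem : nth seg0 sigma i \in mnu (-1) (with_endpoint m c).
    by rewrite nth_i -mset_gt0 -nuAE -has_count has_pred1 map_f.
  have nth_j_mem : nth seg0 sigma j \in with_endpoint m (c - 1).
    by rewrite -mset_gt0 -sigma_order -has_count has_pred1 mem_nth.
  have := proj1 sigma_admissible _ _ nth_i_mem nth_j_mem lt_beg j i.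
  by rewrite !onth_s // => /(_ erefl erefl); rewrite ltnNge ltnW.
have [le_count del_adm] :=
  relevant_deletes c A sigma rho A_sorted end_A end_sigma end_rho sigma_adm grp adm.
split.
  by apply/msubsetP => D; rewrite -nuAE -sigma_order.
move=> sigma' del; split; last exact: del_adm.
- move=> D; rewrite count_cat rhoE !msetE2 -nuAE.
  have := deletes_count_mem _ _ _ D del.
  by rewrite sigma_order !with_endpointE; do 2!case: eqP; lia.
- have sub : subseq (sigma' ++ rho) (A ++ sigma ++ rho).
    apply: subseq_trans (suffix_subseq A _).
    by apply: cat_subseq; rewrite ?(deletes_subseq _ _ _ del).
  by move: standard_m; rewrite /standard; apply: subseq_pairwise.
Qed.
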